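(* Let $m\ge1$, let $\lambda=(\lambda_1,\dots,\lambda_m)$ be an $m$-tuple of real numbers with $0<\lambda_1\le\dots\le\lambda_m$, and let $\mathfrak{d}_{2m+2}^\lambda(\mathbb{R})=\mathbb{R}\cdot\delta_\lambda\oplus\operatorname{span}\langle e_1,\dots,e_{2m}\rangle\oplus\mathbb{R}\cdot\delta_\lambda^*$ be the corresponding real oscillator algebra. For any $t\in\mathbb{R}$ and $s\in\mathbb{R}$ with $s\ne0$, let $\varphi_{t,s}$ be the symmetric bilinear form for which $\mathfrak{d}_{2m+2}^\lambda(\mathbb{R})$ is the orthogonal sum $\operatorname{span}\langle e_1,\dots,e_{2m}\rangle\perp\operatorname{span}\langle\delta_\lambda,\delta_\lambda^*\rangle$, with $\varphi_{t,s}(\delta_\lambda,\delta_\lambda)=t$, $\delta_\lambda^*$ isotropic (that is, $\varphi_{t,s}(\delta_\lambda^*,\delta_\lambda^* )=0$), $\{e_1,\dots,e_{2m}\}$ an orthogonal family, and $\varphi_{t,s}(\delta_\lambda,\delta_\lambda^* )=s=\varphi_{t,s}(e_i,e_i)$ for all $i$. Then $\varphi_{t,s}$ is invariant and nondegenerate. The set $\{\varphi_{t,s}: t,s\in\mathbb{R},\ s\neq0\}$ is the whole set of symmetric invariant and nondegenerate bilinear forms of $\mathfrak{d}_{2m+2}^\lambda(\mathbb{R})$. In particular, $B_{inv}(\mathfrak{d}_{2m+2}^\lambda(\mathbb{R}))=\operatorname{span}\langle\varphi_{0,1},\varphi_{1,1}\rangle$, and the metric dimension of real oscillator algebras is two.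
   Context: The real oscillator algebra $\mathfrak{d}_{2m+2}^\lambda(\mathbb{R})$ is the real Lie algebra with basis $\delta_\lambda,e_1,\dots,e_{2m},\delta_\lambda^*$ whose brackets of basis elements (up to skew-symmetry) are, for $1\le i\le m$: $[e_{2i-1},e_{2i}]=\lambda_i\delta_\lambda^*$, $[\delta_\lambda,e_{2i-1}]=\lambda_ie_{2i}$, $[\delta_\lambda,e_{2i}]=-\lambda_ie_{2i-1}$, and all other brackets of basis elements are zero (so $\delta_\lambda^*$ is central). A bilinear form $\varphi$ on a real Lie algebra $\mathfrak{g}$ is invariant if $\varphi([x,y],z)+\varphi(y,[x,z])=0$ for all $x,y,z\in\mathfrak{g}$. $B_{inv}(\mathfrak{g})$ is the vector space of all invariant bilinear forms on $\mathfrak{g}$ and the metric dimension of $\mathfrak{g}$ is $\dim B_{inv}(\mathfrak{g})$. *)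

(* Defs.v *)
(* MathComp world; the real numbers are an arbitrary [R : realType]. *)
From HB Require Import structures.
From mathcomp Require Import all_boot all_order all_algebra.
From mathcomp Require Import reals ring.

Set Implicit Arguments.
Unset Strict Implicit.
Unset Printing Implicit Defensive.

Import Order.TTheory GRing.Theory Num.Theory.
Local Open Scope ring_scope.

HB.mixin Record isLieAlgebra (R : fieldType) L of Vector R L := {
  lie : L -> L -> L;
  lie_linearl : forall y, linear (lie^~ y);
  lie_linearr : forall x, linear (lie x);
  liexx : forall x, lie x x = 0;
  lie_jacobi : forall x y z,
    lie x (lie y z) + lie y (lie z x) + lie z (lie x y) = 0
}.

(* Finite-dimensional Lie algebras. *)
#[short(type="lieAlgType")]
HB.structure Definition LieAlgebra (R : fieldType) :=
  { L of isLieAlgebra R L & Vector R L }.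

(* A bilinear form is a linear map g -> (g -> R), so that bilinear forms are a
   [vectType] and [f x y] is the value of [f] at x, y. *)
Notation bilform R g := 'Hom(g, 'Hom(g, R^o)).

Lemma linfunE (R : fieldType) (U V : vectType R) (h : U -> V) :
  linear h -> forall x, linfun h x = h x.
Proof.
move=> lin_h x; pose M := GRing.isLinear.Build R U V _ h lin_h.
by pose H : {linear U -> V} := HB.pack h M; exact: (lfunE H).
Qed.

Section CurryLinfun.
Variables (R : fieldType) (U V W : vectType R).

Definition curry_linfun (b : U -> V -> W) : 'Hom(U, 'Hom(V, W)) :=
  linfun (fun x => linfun (b x)).

Lemma curry_linfunE (b : U -> V -> W) :
    (forall y, linear (b^~ y)) -> (forall x, linear (b x)) ->
  forall x y, curry_linfun b x y = b x y.
Proof.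
move=> bl br x y; rewrite /curry_linfun !linfunE //.
move=> c x1 x2; apply/lfunP => z; rewrite add_lfunE scale_lfunE !linfunE //.
exact: bl.
Qed.
End CurryLinfun.

Section Forms.
Variables (R : fieldType) (g : lieAlgType R).
Implicit Types f : bilform R g.

Definition bilform_symmetric f := forall x y, f x y = f y x.

(* Triviality of the left radical; in finite dimension this is equivalent to
   triviality of the right one. *)
Definition bilform_nondegenerate f := forall x, (forall y, f x y = 0) -> x = 0.

Definition bilform_invariant f :=
  forall x y z, f (lie x y) z + f y (lie x z) = 0.

Definition inv_defect f : 'Hom(g, bilform R g) :=
  curry_linfun (fun x y => linfun (fun z => f (lie x y) z + f y (lie x z) : R^o)).

(* The linear [inv_defect f] vanishes iff [f] is invariant; see [mem_Binv]. *)
Definition Binv : {vspace bilform R g} := lker (linfun inv_defect).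

Definition metric_dim : nat := \dim Binv.

Lemma inv_defectE f x y z :
  inv_defect f x y z = f (lie x y) z + f y (lie x z).
Proof.
have lz x1 y1 : linear (fun z => f (lie x1 y1) z + f y1 (lie x1 z) : R^o).
  by move=> c u v; rewrite lie_linearr !linearP /= scalerDr addrACA.
rewrite /inv_defect curry_linfunE ?linfunE //.
- move=> y1 c u v; apply/lfunP => w.
  rewrite add_lfunE scale_lfunE !linfunE // !lie_linearl !linearP /=.
  by rewrite !add_lfunE !scale_lfunE scalerDr addrACA.
- move=> x1 c u v; apply/lfunP => w.
  rewrite add_lfunE scale_lfunE !linfunE // !lie_linearr !linearP /=.
  by rewrite !add_lfunE !scale_lfunE scalerDr addrACA.
Qed.

Lemma mem_Binv f : f \in Binv <-> bilform_invariant f.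
Proof.
have lin : linear inv_defect.
  move=> c f1 f2; apply/lfunP => x; apply/lfunP => y; apply/lfunP => z.
  rewrite !(add_lfunE, scale_lfunE) !inv_defectE !(add_lfunE, scale_lfunE).
  by rewrite scalerDr addrACA.
rewrite memv_ker linfunE //; split=> [/eqP f0 x y z|f0].
  by rewrite -inv_defectE f0 !zero_lfunE.
apply/eqP/lfunP => x; apply/lfunP => y; apply/lfunP => z.
by rewrite inv_defectE f0 !zero_lfunE.
Qed.
End Forms.

Section OscillatorIndices.
Variable m : nat.

Fact idx1_subproof (i : 'I_m) : (i.*2 < m.*2)%N.
Proof. by rewrite ltn_double. Qed.
Fact idx2_subproof (i : 'I_m) : (i.*2.+1 < m.*2)%N.
Proof. by rewrite ltn_Sdouble. Qed.

(* With 0-based indices, e_{2i-1} and e_{2i} are [osc_e (idx1 i)] and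
   [osc_e (idx2 i)]. *)
Definition idx1 (i : 'I_m) : 'I_(m.*2) := Ordinal (idx1_subproof i).
Definition idx2 (i : 'I_m) : 'I_(m.*2) := Ordinal (idx2_subproof i).

Lemma idx_ind (P : 'I_(m.*2) -> Prop) :
  (forall i, P (idx1 i)) -> (forall i, P (idx2 i)) -> forall j, P j.
Proof.
move=> P1 P2 j; have jm : (j./2 < m)%N.
  by rewrite -ltn_double (leq_ltn_trans _ (ltn_ord j)) // -{2}(odd_double_half j) leq_addl.
have := odd_double_half j; case: (odd j) => /= jE.
  by rewrite (_ : j = idx2 (Ordinal jm)) //; apply: val_inj; exact: esym jE.
by rewrite (_ : j = idx1 (Ordinal jm)) //; apply: val_inj; exact: esym jE.
Qed.

Lemma idx11 i j : (idx1 i == idx1 j) = (i == j).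
Proof. by rewrite -!val_eqE /= -!mul2n eqn_pmul2l. Qed.
Lemma idx22 i j : (idx2 i == idx2 j) = (i == j).
Proof. by rewrite -!val_eqE /= eqSS -!mul2n eqn_pmul2l. Qed.
Lemma idx12 i j : (idx1 i == idx2 j) = false.
Proof. by apply/negP => /eqP/(congr1 (odd \o val)) /=; rewrite !odd_double. Qed.
Lemma idx21 i j : (idx2 i == idx1 j) = false.
Proof. by rewrite eq_sym idx12. Qed.
End OscillatorIndices.

(* (a, v, b) stands for a delta + \sum_j v_j e_j + b delta^*. *)
Definition oscillator (R : realType) (m : nat) (lam : 'I_m -> R) : Type :=
  (R^o * 'rV[R]_(m.*2) * R^o)%type.

Section Oscillator.
Variables (R : realType) (m : nat) (lam : 'I_m -> R).
Notation osc := (oscillator lam).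

HB.instance Definition _ :=
  Vector.copy osc (R^o * 'rV[R]_(m.*2) * R^o)%type.

Definition osc_delta : osc := (1, 0, 0).
Definition osc_e (j : 'I_(m.*2)) : osc := (0, delta_mx 0 j, 0).
Definition osc_deltas : osc := (0, 0, 1).

(* The bilinear extension of the brackets of basis elements, which are listed
   in [lie_oscE]. *)
Definition osc_lie (x y : osc) : osc :=
  let: (a, v, _) := x in let: (a', v', _) := y in
  (0,
   \sum_(i < m) lam i *:
      ((a * v' 0 (idx1 i) - a' * v 0 (idx1 i)) *: delta_mx 0 (idx2 i)
     - (a * v' 0 (idx2 i) - a' * v 0 (idx2 i)) *: delta_mx 0 (idx1 i)),
   \sum_(i < m) lam i *
      (v 0 (idx1 i) * v' 0 (idx2 i) - v 0 (idx2 i) * v' 0 (idx1 i))).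

Let rot (p q : 'I_m -> R) : 'rV[R]_(m.*2) :=
  \sum_(i < m) lam i *: (p i *: delta_mx 0 (idx2 i) - q i *: delta_mx 0 (idx1 i)).

Let rot1 p q i : rot p q 0 (idx1 i) = - lam i * q i.
Proof.
rewrite summxE (bigD1 i) //= !mxE !eqxx idx12 big1 => [|k /negPf ki].
  by rewrite /=; ring.
by rewrite !mxE eqxx idx12 idx11 eq_sym ki /=; ring.
Qed.

Let rot2 p q i : rot p q 0 (idx2 i) = lam i * p i.
Proof.
rewrite summxE (bigD1 i) //= !mxE !eqxx idx21 big1 => [|k /negPf ki].
  by rewrite /=; ring.
by rewrite !mxE eqxx idx21 idx22 eq_sym ki /=; ring.
Qed.

Let rowP (v w : 'rV[R]_(m.*2)) :
  (forall i, v 0 (idx1 i) = w 0 (idx1 i)) ->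
  (forall i, v 0 (idx2 i) = w 0 (idx2 i)) -> v = w.
Proof. by move=> h1 h2; apply/rowP; apply: idx_ind. Qed.

Let oscP (a a' b b' : R^o) (v v' : 'rV[R]_(m.*2)) :
  a = a' -> v = v' -> b = b' -> (a, v, b) = (a', v', b') :> osc.
Proof. by move=> -> -> ->. Qed.

Let scoE (c : R) (a : R^o) : c *: a = c * a. Proof. by []. Qed.

Fact osc_lie_linearl y : linear (osc_lie^~ y).
Proof.
case: y => [[a' v'] b'] c [[a1 v1] b1] [[a2 v2] b2]; apply: oscP => /=.
- by rewrite scaler0 addr0.
- by apply: rowP => i; rewrite 2!mxE !(rot1, rot2) !mxE ?scoE; ring.
- rewrite scoE mulr_sumr -big_split; apply: eq_bigr => i _ /=.
  by rewrite !mxE ?scoE; ring.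
Qed.

Fact osc_lie_linearr x : linear (osc_lie x).
Proof.
case: x => [[a' v'] b'] c [[a1 v1] b1] [[a2 v2] b2]; apply: oscP => /=.
- by rewrite scaler0 addr0.
- by apply: rowP => i; rewrite 2!mxE !(rot1, rot2) !mxE ?scoE; ring.
- rewrite scoE mulr_sumr -big_split; apply: eq_bigr => i _ /=.
  by rewrite !mxE ?scoE; ring.
Qed.

Fact osc_liexx x : osc_lie x x = 0.
Proof.
case: x => [[a v] b]; apply: oscP => //.
- by apply: rowP => i; rewrite !(rot1, rot2) !mxE ?scoE; ring.
- by rewrite big1 // => i _; ring.
Qed.

Fact osc_jacobi x y z :
  osc_lie x (osc_lie y z) + osc_lie y (osc_lie z x) + osc_lie z (osc_lie x y)
  = 0.
Proof.
case: x y z => [[a v] b] [[a' v'] b'] [[a2 v2] b2]; apply: oscP => /=.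
- by rewrite !addr0.
- by apply: rowP => i; rewrite 2!mxE !(rot1, rot2) !mxE ?scoE; ring.
- rewrite -!big_split big1 //= => i _.
  by rewrite !(rot1, rot2); ring.
Qed.

HB.instance Definition _ := isLieAlgebra.Build R osc
  osc_lie_linearl osc_lie_linearr osc_liexx osc_jacobi.

Lemma oscE (x : osc) :
  x = x.1.1 *: osc_delta + \sum_j x.1.2 0 j *: osc_e j + x.2 *: osc_deltas.
Proof.
have -> : \sum_j x.1.2 0 j *: osc_e j = ((0, x.1.2, 0) : osc).
  rewrite [in RHS](row_sum_delta x.1.2).
  elim/big_rec2: _ => // j w _ _ ->; apply: oscP => //=.
    by rewrite scaler0 addr0.
  by rewrite scaler0 addr0.
case: x => [[a v] b]; apply: oscP => /=.
- by rewrite scaler0 !addr0 scoE mulr1.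
- by rewrite !scaler0 add0r addr0.
- by rewrite !scaler0 !add0r scoE mulr1.
Qed.

Lemma osc_basis :
  basis_of {:osc} (osc_delta :: [seq osc_e j | j : 'I_(m.*2)] ++ [:: osc_deltas]).
Proof.
have dimE : dim osc = (1 + 1 * m.*2 + 1)%N by [].
rewrite basisEdim dimvf dimE /= size_cat size_map size_enum_ord /=.
rewrite mul1n -addnA add1n leqnn andbT.
apply/subvP => x _; rewrite (oscE x); apply: rpredD; first apply: rpredD.
- by apply/rpredZ/memv_span; rewrite inE eqxx.
- apply: rpred_sum => j _; apply/rpredZ/memv_span.
  by rewrite inE mem_cat map_f ?mem_enum ?orbT.
- by apply/rpredZ/memv_span; rewrite inE mem_cat mem_seq1 eqxx !orbT.
Qed.

Lemma lie_oscE :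
  [/\ forall i j, lie (osc_e (idx1 i)) (osc_e (idx2 j)) =
        if i == j then lam i *: osc_deltas else 0,
      forall i j, lie (osc_e (idx1 i)) (osc_e (idx1 j)) = 0,
      forall i j, lie (osc_e (idx2 i)) (osc_e (idx2 j)) = 0,
      forall i, lie osc_delta (osc_e (idx1 i)) = lam i *: osc_e (idx2 i)
                /\ lie osc_delta (osc_e (idx2 i)) = - lam i *: osc_e (idx1 i)
    & forall x, lie x osc_deltas = 0].
Proof.
have ee j k : lie (osc_e j) (osc_e k) = (0, 0, \sum_(l < m) lam l *
    ((idx1 l == j)%:R * (idx2 l == k)%:R - (idx2 l == j)%:R * (idx1 l == k)%:R)).
  apply: oscP => //; last by apply: eq_bigr => l _; rewrite !mxE !eqxx.
  by apply: rowP => l; rewrite !(rot1, rot2) !mxE ?scoE; ring.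
split=> [i j|i j|i j|i|x].
- rewrite ee; have [<-|ij] := eqVneq i j; apply: oscP; rewrite ?scaler0 //.
    rewrite scoE (bigD1 i) //= big1 => [|k /negPf ki].
      by rewrite !eqxx idx12 idx21 /=; ring.
    by rewrite idx11 idx22 idx12 idx21 ki /=; ring.
  rewrite big1 // => k _; rewrite idx11 idx22 idx12 idx21.
  by have [->|_] := eqVneq k i; rewrite ?(negPf ij) /=; ring.
- by rewrite ee; apply: oscP; rewrite // big1 // => k _; rewrite !idx21 /=; ring.
- by rewrite ee; apply: oscP; rewrite // big1 // => k _; rewrite !idx12 /=; ring.
- split; apply: oscP; rewrite /= ?scaler0 //.
  + apply: rowP => k; rewrite !(rot1, rot2) !mxE ?(idx11, idx12, idx21, idx22) /=.
      by ring.
    by case: (eqVneq k i) => [->|_] /=; ring.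
  + by rewrite big1 // => k _; rewrite !mxE ?scoE; ring.
  + apply: rowP => k; rewrite !(rot1, rot2) !mxE ?(idx11, idx12, idx21, idx22) /=.
      by case: (eqVneq k i) => [->|_] /=; ring.
    by ring.
  + by rewrite big1 // => k _; rewrite !mxE ?scoE; ring.
- case: x => [[a v] b]; apply: oscP => //=.
    by apply: rowP => i; rewrite !(rot1, rot2) !mxE ?scoE; ring.
  by rewrite big1 // => i _; rewrite !mxE ?scoE; ring.
Qed.

(* Only meant for s != 0; [osc_formP] characterizes it on the basis. *)
Definition osc_form (t s : R) : bilform R osc :=
  curry_linfun (fun x y : osc =>
    let: (a, v, b) := x in let: (a', v', b') := y in
    t * (a * a') + s * (a * b' + b * a')
    + \sum_(j < m.*2) s * (v 0 j * v' 0 j) : R^o).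

Let osc_formE t s a v b a' v' b' :
  osc_form t s (a, v, b) (a', v', b') =
    t * (a * a') + s * (a * b' + b * a')
    + \sum_(j < m.*2) s * (v 0 j * v' 0 j).
Proof.
have aux (c a0 b0 a1 b1 a2 b2 : R) :
  t * ((c * a1 + a2) * a0) + s * ((c * a1 + a2) * b0 + (c * b1 + b2) * a0) =
  c * (t * (a1 * a0) + s * (a1 * b0 + b1 * a0)) +
  (t * (a2 * a0) + s * (a2 * b0 + b2 * a0)) by ring.
have aux' (c a0 b0 a1 b1 a2 b2 : R) :
  t * (a0 * (c * a1 + a2)) + s * (a0 * (c * b1 + b2) + b0 * (c * a1 + a2)) =
  c * (t * (a0 * a1) + s * (a0 * b1 + b0 * a1)) +
  (t * (a0 * a2) + s * (a0 * b2 + b0 * a2)) by ring.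
have aux2 (c v0 v1 v2 : R) :
  s * ((c * v1 + v2) * v0) = c * (s * (v1 * v0)) + s * (v2 * v0) by ring.
have aux2' (c v0 v1 v2 : R) :
  s * (v0 * (c * v1 + v2)) = c * (s * (v0 * v1)) + s * (v0 * v2) by ring.
rewrite /osc_form curry_linfunE //.
- move=> [[a0 v0] b0] c [[a1 v1] b1] [[a2 v2] b2] /=.
  rewrite !scoE [in RHS]mulrDr [RHS]addrACA mulr_sumr -big_split.
  congr (_ + _); first exact: aux.
  by apply: eq_bigr => i _; rewrite !mxE; exact: aux2.
- move=> [[a0 v0] b0] c [[a1 v1] b1] [[a2 v2] b2] /=.
  rewrite !scoE [in RHS]mulrDr [RHS]addrACA mulr_sumr -big_split.
  congr (_ + _); first exact: aux'.
  by apply: eq_bigr => i _; rewrite !mxE; exact: aux2'.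
Qed.

Let osc_formE' t s (x y : osc) :
  osc_form t s x y =
    t * (x.1.1 * y.1.1) + s * (x.1.1 * y.2 + x.2 * y.1.1)
    + \sum_(j < m.*2) s * (x.1.2 0 j * y.1.2 0 j).
Proof. by case: x y => [[a v] b] [[a' v'] b']; exact: osc_formE. Qed.

Lemma osc_formP t s (f : bilform R osc) :
  f = osc_form t s <->
  bilform_symmetric f /\
  [/\ forall j, f (osc_e j) osc_delta = 0,
      forall j, f (osc_e j) osc_deltas = 0,
      forall j k, j != k -> f (osc_e j) (osc_e k) = 0,
      forall j, f (osc_e j) (osc_e j) = s
    & [/\ f osc_delta osc_delta = t,
          f osc_delta osc_deltas = s
        & f osc_deltas osc_deltas = 0]].
Proof.
have sumd j k : \sum_(l < m.*2) s * (delta_mx (0 : 'I_1) j 0 l * delta_mx (0 : 'I_1) k 0 l)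
    = s * (j == k)%:R.
  rewrite (bigD1 j) //= big1 => [|l /negPf lj]; rewrite !mxE ?eqxx ?lj /=; ring.
have sym_phi : bilform_symmetric (osc_form t s).
  move=> [[a v] b] [[a' v'] b']; rewrite !osc_formE; congr (_ + _); first by ring.
  by apply: eq_bigr => j _; ring.
have phiP : [/\ forall j, osc_form t s (osc_e j) osc_delta = 0,
      forall j, osc_form t s (osc_e j) osc_deltas = 0,
      forall j k, j != k -> osc_form t s (osc_e j) (osc_e k) = 0,
      forall j, osc_form t s (osc_e j) (osc_e j) = s
    & [/\ osc_form t s osc_delta osc_delta = t,
          osc_form t s osc_delta osc_deltas = s
        & osc_form t s osc_deltas osc_deltas = 0]].
{ split=> [j|j|j k /negPf jk|j|]; last split.
  all: rewrite osc_formE' /= ?sumd ?eqxx ?jk /=.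
  all: do ?[rewrite big1 => [|i _]; last by rewrite !mxE ?(mulr0, mul0r)].
  all: by rewrite !(mulr0, mul0r, add0r, addr0, mulr1). }
split=> [->|[sym_f [f1 f2 f3 f4 [f5 f6 f7]]]]; first by [].
case: phiP => p1 p2 p3 p4 [p5 p6 p7].
have ext (h h' : 'Hom(osc, R^o)) : h osc_delta = h' osc_delta ->
    (forall j, h (osc_e j) = h' (osc_e j)) -> h osc_deltas = h' osc_deltas -> h = h'.
  move=> e1 e2 e3; apply/lfunP => x; rewrite (oscE x) !linearD !linearZ /= e1 e3.
  by rewrite !linear_sum; congr (_ + _ + _); apply: eq_bigr => j _; rewrite !linearZ /= e2.
have ext2 (h h' : bilform R osc) : h osc_delta = h' osc_delta ->
    (forall j, h (osc_e j) = h' (osc_e j)) -> h osc_deltas = h' osc_deltas -> h = h'.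
  move=> e1 e2 e3; apply/lfunP => x; rewrite (oscE x) !linearD !linearZ /= e1 e3.
  by rewrite !linear_sum; congr (_ + _ + _); apply: eq_bigr => j _; rewrite !linearZ /= e2.
apply: ext2 => [|j|]; apply: ext => [|k|].
- by rewrite f5 p5.
- by rewrite sym_f sym_phi f1 p1.
- by rewrite f6 p6.
- by rewrite f1 p1.
- by have [->|jk] := eqVneq j k; rewrite ?f4 ?p4 ?f3 ?p3.
- by rewrite f2 p2.
- by rewrite sym_f sym_phi f6 p6.
- by rewrite sym_f sym_phi f2 p2.
- by rewrite f7 p7.
Qed.
End Oscillator.

(* Main.v *)
Require Import Defs.
From mathcomp Require Import all_boot all_order all_algebra.
From mathcomp Require Import reals.
From mathcomp Require Import ring.

Import Order.TTheory GRing.Theory Num.Theory.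
Local Open Scope ring_scope.

(** Write d for [osc_delta], z for [osc_deltas], and p_i, q_i for
    [osc_e (idx1 i)], [osc_e (idx2 i)].

    For an invariant form f, symmetric or not, the trilinear function
    f([x,y],w) = f(x,[y,w]) is invariant under cyclic rotation of (x, y, w),
    and f([x,y],w) = f(w,[x,y]) ([invariant_rot], [invariant_lie_comm]).  In
    the oscillator algebra every basis vector except d is a bracket up to a
    nonzero scalar: lam_i p_i = [q_i,d], lam_i q_i = [d,p_i] and
    lam_i z = [p_i,q_i].  Hence every invariant form is symmetric, and after
    rotation lam_i f(p_i,w) = f([w,q_i],d) and lam_i f(q_i,w) = f([p_i,w],d).
    Letting w run over the basis gives f(p_i,p_i) = f(q_i,q_i) = f(z,d) and
    makes all other values involving an e_j vanish; f(z,z) = 0 because z is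
    central and a multiple of a bracket; f(d,d) is unconstrained.  So
    f = [osc_form t s] with t = f(d,d) and s = f(d,z) ([invariant_osc_form]).

    Conversely, for f = [osc_form t s] the number f([x,y],w) is s times a
    combination of 3 x 3 determinants in the coordinates of x, y, w, hence
    alternating, and f is invariant ([osc_form_lie], [osc_form_invariant]).
    If s = 0 then z is in the radical, and if s <> 0 then pairing with basis
    vectors recovers all coordinates of a vector.  Since [osc_form t s] is
    linear in (t, s) and its values at (d,d) and (d,z) are t and s, the
    invariant forms make up a plane, with basis [osc_form 0 1],
    [osc_form 1 1]. *)

(** * Bilinear forms on a vector space *)

Section BilinearForms.
Variables (F : fieldType) (U : vectType F).
Implicit Types f u v : 'Hom(U, 'Hom(U, F^o)).

(** The combinations that occur here are those of [osc_lie_expand]. *)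
Lemma bilform_suml f n (c a1 a2 a3 : 'I_n -> F) (x1 x2 : 'I_n -> U) x3 y :
  f (\sum_(i < n) c i *: (a1 i *: x1 i - a2 i *: x2 i + a3 i *: x3)) y =
  \sum_(i < n) c i * (a1 i * f (x1 i) y - a2 i * f (x2 i) y + a3 i * f x3 y).
Proof.
rewrite linear_sum sum_lfunE; apply: eq_bigr => i _.
rewrite linearZ linearD linearB !linearZ /=.
by rewrite !(scale_lfunE, add_lfunE, opp_lfunE) scalerN.
Qed.

(** The combinations that occur here are those of [oscE]. *)
Lemma bilform_lin3 f n (a b : F) (c : 'I_n -> F) x z (e : 'I_n -> U) y :
  f (a *: x + \sum_j c j *: e j + b *: z) y =
  a * f x y + \sum_j c j * f (e j) y + b * f z y.
Proof.
rewrite !linearD linear_sum !linearZ /= !(add_lfunE, scale_lfunE, sum_lfunE).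
by congr (_ + _ + _); apply: eq_bigr => j _; rewrite linearZ /= scale_lfunE.
Qed.

Lemma bilform_span2 f u v a b :
  (forall x y, f x y = a * u x y + b * v x y) -> f \in <<[:: u; v]>>%VS.
Proof.
move=> fE; have -> : f = a *: u + b *: v.
  apply/lfunP => x; apply/lfunP => y.
  by rewrite fE !(add_lfunE, scale_lfunE).
by apply: rpredD; apply/rpredZ/memv_span; rewrite !inE eqxx ?orbT.
Qed.

(** A nonzero 2 x 2 minor of values excludes a linear relation between two
    forms. *)
Lemma bilform_free2 u v x y y' :
  u x y * v x y' - u x y' * v x y != 0 -> free [:: u; v].
Proof.
move=> det_neq0.
rewrite free_cons seq1_free span_seq1; apply/andP; split.
  apply: contraNN det_neq0 => /vlineP[k ->].
  by rewrite !scale_lfunE; apply/eqP; rewrite /GRing.scale /=; ring.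
by apply: contraNneq det_neq0 => ->; rewrite !zero_lfunE !mulr0 subr0.
Qed.

End BilinearForms.

(** * Invariant forms on a Lie algebra *)

Section InvariantForms.
Context {F : fieldType} {g : lieAlgType F} {f : bilform F g}.
Hypothesis f_inv : bilform_invariant f.

Lemma lie_anticomm (x y : g) : lie x y = - lie y x.
Proof.
have addl u v w : lie (u + v) w = lie u w + lie v w :> g.
  by have := lie_linearl w 1 u v; rewrite !scale1r.
have addr u v w : lie w (u + v) = lie w u + lie w v :> g.
  by have := lie_linearr w 1 u v; rewrite !scale1r.
have := liexx (x + y); rewrite addl !addr !liexx add0r addr0.
by move/eqP; rewrite addr_eq0 => /eqP.
Qed.

Lemma invariant_assoc x y w : f (lie x y) w = f x (lie y w).
Proof.
rewrite lie_anticomm linearN /= opp_lfunE; apply/eqP.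
by rewrite eqr_oppLR -addr_eq0 f_inv.
Qed.

(** No symmetry of [f] is assumed: f([x,y],w) = f(x,[y,w]) = - f(x,[w,y])
    = - f([x,w],y) = f([w,x],y) = f(w,[x,y]). *)
Lemma invariant_lie_comm x y w : f (lie x y) w = f w (lie x y).
Proof.
rewrite invariant_assoc (lie_anticomm y) linearN /= -(invariant_assoc x w).
by rewrite (lie_anticomm x) linearN /= opp_lfunE opprK invariant_assoc.
Qed.

Lemma invariant_rot x y w : f (lie x y) w = f (lie y w) x.
Proof. by rewrite invariant_assoc invariant_lie_comm. Qed.

End InvariantForms.

(** * The standard forms on the oscillator algebra *)

Section OscForms.
Context {R : realType} {m : nat} (lam : 'I_m -> R).
Notation osc := (oscillator lam).
Notation d := (osc_delta lam).
Notation e := (osc_e lam).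
Notation z := (osc_deltas lam).
Implicit Types x y w : osc.

Lemma osc_lie_expand x y :
  lie x y = \sum_(i < m) lam i *:
      ((x.1.1 * y.1.2 0 (idx1 i) - y.1.1 * x.1.2 0 (idx1 i)) *: e (idx2 i)
     - (x.1.1 * y.1.2 0 (idx2 i) - y.1.1 * x.1.2 0 (idx2 i)) *: e (idx1 i)
     + (x.1.2 0 (idx1 i) * y.1.2 0 (idx2 i)
        - x.1.2 0 (idx2 i) * y.1.2 0 (idx1 i)) *: z).
Proof.
case: x y => [[a v] b] [[a' v'] b'].
rewrite /lie /= /osc_lie /osc_e /osc_deltas.
elim/big_rec3: _ => // i w1 w2 w3 _ <-.
congr (_, _, _) => /=.
- by rewrite /GRing.scale /=; ring.
- by rewrite scaler0 addr0.
- by rewrite /GRing.scale /=; ring.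
Qed.

Section Values.
Variables t s : R.
Notation phi := (osc_form lam t s).

Lemma osc_form_sym : bilform_symmetric phi.
Proof. by case: (osc_formP t s phi) => /(_ erefl) []. Qed.

Lemma osc_form_eE j w : phi (e j) w = s * w.1.2 0 j.
Proof.
case: (osc_formP t s phi) => /(_ erefl) [_ [ed ez ek ej _]] _.
rewrite {1}(oscE w) !linearD !linearZ linear_sum /= ed ez.
rewrite (bigD1 j) //= linearZ /= ej big1 => [|k kj]; last first.
  by rewrite linearZ /= ek 1?eq_sym // scaler0.
by rewrite !scaler0 !addr0 add0r /GRing.scale /= mulrC.
Qed.

Lemma osc_form_deltasE w : phi z w = s * w.1.1.
Proof.
case: (osc_formP t s phi) => /(_ erefl) [phi_sym [_ ez _ _ [_ dz zz]]] _.
rewrite {1}(oscE w) !linearD !linearZ linear_sum /= zz phi_sym dz.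
rewrite big1 => [|k _]; last by rewrite linearZ /= phi_sym ez scaler0.
by rewrite scaler0 !addr0 /GRing.scale /= mulrC.
Qed.

Lemma osc_form_deltaE w : phi d w = t * w.1.1 + s * w.2.
Proof.
case: (osc_formP t s phi) => /(_ erefl) [phi_sym [ed _ _ _ [dd dz _]]] _.
rewrite {1}(oscE w) !linearD !linearZ linear_sum /= dd dz.
rewrite big1 => [|k _]; last by rewrite linearZ /= phi_sym ed scaler0.
by rewrite addr0 /GRing.scale /=; ring.
Qed.

(** Each summand is lam_i times the determinant of the coordinates of x, y, w
    along d, p_i and q_i, expanded along the row of w; in particular the whole
    is alternating in x, y, w. *)
Lemma osc_form_lie x y w : phi (lie x y) w = s * \sum_(i < m) lam i *
     ((x.1.1 * y.1.2 0 (idx1 i) - y.1.1 * x.1.2 0 (idx1 i)) * w.1.2 0 (idx2 i)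
    - (x.1.1 * y.1.2 0 (idx2 i) - y.1.1 * x.1.2 0 (idx2 i)) * w.1.2 0 (idx1 i)
    + (x.1.2 0 (idx1 i) * y.1.2 0 (idx2 i)
       - x.1.2 0 (idx2 i) * y.1.2 0 (idx1 i)) * w.1.1).
Proof.
rewrite osc_lie_expand bilform_suml mulr_sumr; apply: eq_bigr => i _.
by rewrite !osc_form_eE osc_form_deltasE; ring.
Qed.

Lemma osc_form_invariant : bilform_invariant phi.
Proof.
move=> x y w; rewrite (osc_form_sym y) !osc_form_lie -mulrDr -big_split big1.
  by rewrite mulr0.
by move=> i _ /=; ring.
Qed.

(** Pairing with z, then the e_j, then d reads off the coordinates of a vector
    along d, the e_j and z, up to the factor [s]. *)
Lemma osc_form_nondegenerate : s != 0 -> bilform_nondegenerate phi.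
Proof.
move=> s0 x phix0.
have x1 : x.1.1 = 0.
  by apply/(mulfI s0); rewrite mulr0 -osc_form_deltasE osc_form_sym.
have x2 j : x.1.2 0 j = 0.
  by apply/(mulfI s0); rewrite mulr0 -osc_form_eE osc_form_sym.
have x3 : x.2 = 0.
  apply/(mulfI s0); rewrite mulr0 -(phix0 d) osc_form_sym osc_form_deltaE x1.
  by rewrite mulr0 add0r.
rewrite (oscE x) x1 x3 !scale0r add0r addr0 big1 // => j _.
by rewrite x2 scale0r.
Qed.

End Values.

(** For s = 0 the central element z lies in the radical. *)
Lemma osc_form_nondegenerate_neq0 t s :
  bilform_nondegenerate (osc_form lam t s) -> s != 0.
Proof.
move=> nondeg; apply/eqP => s0.
have /(congr1 snd)/eqP : z = 0.
  by apply: nondeg => w; rewrite osc_form_deltasE s0 mul0r.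
by rewrite /= oner_eq0.
Qed.

Lemma osc_formE t s x y : osc_form lam t s x y =
  t * (x.1.1 * y.1.1) + s * (x.1.1 * y.2 + x.2 * y.1.1
                             + \sum_j x.1.2 0 j * y.1.2 0 j).
Proof.
rewrite {1}(oscE x) bilform_lin3 osc_form_deltaE osc_form_deltasE.
under eq_bigr do rewrite osc_form_eE mulrCA.
by rewrite -mulr_sumr; ring.
Qed.

Lemma osc_form_span t s :
  osc_form lam t s \in <<[:: osc_form lam 0 1; osc_form lam 1 1]>>%VS.
Proof.
apply: (bilform_span2 _ _ _ _ _ (s - t) t) => x y.
by rewrite !osc_formE; ring.
Qed.

Lemma osc_form_free : free [:: osc_form lam 0 1; osc_form lam 1 1].
Proof.
apply: (bilform_free2 _ _ _ _ d d z); rewrite !osc_form_deltaE /=.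
rewrite !(mul0r, mulr1, mulr0, mul1r, add0r, addr0).
by rewrite oppr_eq0 oner_neq0.
Qed.

(** * Invariant forms on the oscillator algebra *)

Section InvariantClassification.
Context {f : bilform R osc}.
Hypotheses (m_gt0 : (0 < m)%N) (lam_neq0 : forall i, lam i != 0).
Hypothesis f_inv : bilform_invariant f.

(** Up to the factor lam_i, both p_i and q_i are brackets with d, so rotation
    expresses their pairings through the linear form f(., d) on brackets. *)
Lemma invariant_e1 i w : lam i * f (e (idx1 i)) w = - f (lie (e (idx2 i)) w) d.
Proof.
case: (lie_oscE lam) => _ _ _ /(_ i)[_ dq] _.
rewrite -(invariant_rot f_inv d) dq linearZ /= scale_lfunE /GRing.scale /=.
by rewrite mulNr opprK.
Qed.

Lemma invariant_e2 i w : lam i * f (e (idx2 i)) w = f (lie (e (idx1 i)) w) d.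
Proof.
case: (lie_oscE lam) => _ _ _ /(_ i)[dp _] _.
by rewrite -(invariant_rot f_inv d) dp linearZ /= scale_lfunE.
Qed.

(** Brackets commute with everything under [f], and e_j is one up to a nonzero
    factor; likewise z below, for which at least one pair p_i, q_i is needed. *)
Lemma invariant_e_comm j w : f (e j) w = f w (e j).
Proof.
case: (lie_oscE lam) => _ _ _ de _.
elim/idx_ind: j => i; have [dp dq] := de i; apply: (mulfI (lam_neq0 i)).
  have := invariant_lie_comm f_inv d (e (idx2 i)) w.
  rewrite dq !linearZ /= scale_lfunE /GRing.scale /= !mulNr.
  by move/oppr_inj.
have := invariant_lie_comm f_inv d (e (idx1 i)) w.
by rewrite dp !linearZ /= scale_lfunE.
Qed.

Lemma invariant_deltas_comm w : f z w = f w z.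
Proof.
case: (lie_oscE lam) => pq _ _ _ _.
pose i := Ordinal m_gt0; apply: (mulfI (lam_neq0 i)).
have := invariant_lie_comm f_inv (e (idx1 i)) (e (idx2 i)) w.
by rewrite pq eqxx !linearZ /= scale_lfunE.
Qed.

(** Only d is not a multiple of a bracket, and f(d,d) is symmetric anyway. *)
Lemma invariant_symmetric : bilform_symmetric f.
Proof.
have f_d y : f d y = f y d.
  rewrite {1 2}(oscE y) !(linearD, linearZ, linear_sum) /=.
  rewrite !(add_lfunE, scale_lfunE, sum_lfunE) invariant_deltas_comm.
  congr (_ + _ + _); apply: eq_bigr => j _.
  by rewrite linearZ /= linearZ /= scale_lfunE invariant_e_comm.
move=> x y; rewrite {1 2}(oscE x) !(linearD, linearZ, linear_sum) /=.
rewrite !(add_lfunE, scale_lfunE, sum_lfunE) f_d invariant_deltas_comm.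
congr (_ + _ + _); apply: eq_bigr => j _.
by rewrite linearZ /= linearZ /= scale_lfunE invariant_e_comm.
Qed.

(** [invariant_rot] turns f([y,d],d) into f([d,d],y) = 0. *)
Lemma invariant_e_delta j : f (e j) d = 0.
Proof.
have lie_dd y : f (lie y d) d = 0.
  by rewrite invariant_rot // liexx linear0 zero_lfunE.
elim/idx_ind: j => i; apply: (mulfI (lam_neq0 i)); rewrite mulr0.
  by rewrite invariant_e1 lie_dd oppr0.
by rewrite invariant_e2 lie_dd.
Qed.

Lemma invariant_e_deltas j : f (e j) z = 0.
Proof.
case: (lie_oscE lam) => _ _ _ _ lz.
elim/idx_ind: j => i; apply: (mulfI (lam_neq0 i)); rewrite mulr0.
  by rewrite invariant_e1 lz linear0 zero_lfunE oppr0.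
by rewrite invariant_e2 lz linear0 zero_lfunE.
Qed.

(** lam_i f(z,z) = f([p_i,q_i],z) = f(p_i,[q_i,z]) = 0, as z is central. *)
Lemma invariant_deltas_deltas : f z z = 0.
Proof.
case: (lie_oscE lam) => pq _ _ _ lz; pose i := Ordinal m_gt0.
apply: (mulfI (lam_neq0 i)); rewrite mulr0.
have := invariant_assoc f_inv (e (idx1 i)) (e (idx2 i)) z.
by rewrite pq eqxx lz linear0 linearZ /= scale_lfunE.
Qed.

(** The bracket left in [invariant_e1] and [invariant_e2] is lam_i z when the
    two vectors agree, up to the sign, and 0 otherwise. *)
Lemma invariant_ee j k : f (e j) (e k) = if j == k then f d z else 0.
Proof.
case: (lie_oscE lam) => pq pp qq _ _; rewrite -(invariant_deltas_comm d).
elim/idx_ind: j => i; apply: (mulfI (lam_neq0 i));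
  rewrite ?invariant_e1 ?invariant_e2; elim/idx_ind: k => l.
- rewrite lie_anticomm pq idx11 eq_sym linearN /= opp_lfunE opprK.
  case: eqP => [->|_]; first by rewrite linearZ /= scale_lfunE.
  by rewrite linear0 zero_lfunE mulr0.
- by rewrite qq idx12 linear0 zero_lfunE oppr0 mulr0.
- by rewrite pp idx21 linear0 zero_lfunE mulr0.
- rewrite pq idx22.
  case: eqP => [_|_]; first by rewrite linearZ /= scale_lfunE.
  by rewrite linear0 zero_lfunE mulr0.
Qed.

Lemma invariant_osc_form : f = osc_form lam (f d d) (f d z).
Proof.
apply/osc_formP; split; first exact: invariant_symmetric.
split=> [j|j|j k /negPf jk|j|].
- exact: invariant_e_delta.
- exact: invariant_e_deltas.
- by rewrite invariant_ee jk.
- by rewrite invariant_ee eqxx.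
- by split=> //; exact: invariant_deltas_deltas.
Qed.

End InvariantClassification.

Lemma Binv_oscillator : (0 < m)%N -> (forall i, lam i != 0) ->
  Binv osc = <<[:: osc_form lam 0 1; osc_form lam 1 1]>>%VS.
Proof.
move=> m_gt0 lam_neq0; apply/eqP; rewrite eqEsubv; apply/andP; split.
  apply/subvP => f /mem_Binv f_inv.
  have -> := invariant_osc_form m_gt0 lam_neq0 f_inv.
  exact: osc_form_span.
apply/span_subvP => f; rewrite !inE => /orP[] /eqP ->;
  exact/mem_Binv/osc_form_invariant.
Qed.

End OscForms.

Theorem lemma1 (R : realType) (m : nat) (lam : 'I_m -> R)
  (m_gt0 : (0 < m)%N)
  (lam_gt0 : forall i : 'I_m, 0 < lam i)
  (lam_le : forall i j : 'I_m, (i <= j)%N -> lam i <= lam j) :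
  [/\ forall t s : R, s != 0 ->
        bilform_invariant (osc_form lam t s) /\
        bilform_nondegenerate (osc_form lam t s),
      forall f : bilform R (oscillator lam),
        [/\ bilform_symmetric f, bilform_invariant f & bilform_nondegenerate f] <->
        exists t s : R, s != 0 /\ f = osc_form lam t s,
      Binv (oscillator lam) = <<[:: osc_form lam 0 1; osc_form lam 1 1]>>%VS
    & metric_dim (oscillator lam) = 2%N].
Proof.
have lam_neq0 i : lam i != 0 by rewrite gt_eqF.
have BinvE := Binv_oscillator lam m_gt0 lam_neq0.
split=> //.
- move=> t s s_neq0; split; first exact: osc_form_invariant.
  exact: osc_form_nondegenerate.
- move=> f; split=> [[_ f_inv]|[t [s [s_neq0 ->]]]].
    rewrite (invariant_osc_form lam m_gt0 lam_neq0 f_inv).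
    by move=> /osc_form_nondegenerate_neq0 s_neq0; do 2 eexists; split; first exact: s_neq0.
  split; [exact: osc_form_sym | exact: osc_form_invariant |].
  exact: osc_form_nondegenerate.
- rewrite /metric_dim BinvE; exact/eqP/osc_form_free.
Qed.
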